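(* Let $X\subseteq\prod_{i\in[r]}\mathbb R^{d_i}$ be a set definable (with parameters) in the structure $\langle\mathbb R,<,+,\mathbb Z\rangle$. Then $Zar(X)$ holds: there is $\alpha\in\mathbb R_{>0}$ such that if $X$ is $k$-free for some $k\ge1$, then $|X\cap B|\le\alpha\,\delta(B)$ for every finite grid $B$.
   Context: $\langle\mathbb R,<,+,\mathbb Z\rangle$ is the ordered additive group of reals expanded by a unary predicate for the integers. Fix positive integers $r,d_1,\dots,d_r$, $[r]=\{1,\dots,r\}$. A grid is a product $B=B_1\times\dots\times B_r$ with $B_i\subseteq\mathbb R^{d_i}$; it is finite if each $B_i$ is finite, a $k$-grid if $|B_i|=k$ for all $i$. $X$ is $k$-free if it contains no $k$-grid. For a finite grid, $\delta(B)=\sum_{1\le i_1<\dots<i_{r-1}\le r}\prod_{j=1}^{r-1}|B_{i_j}|$. *)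

(* Defs.v *)
From HB Require Import structures.
From Stdlib Require Import Reals.
From mathcomp Require Import all_boot all_order all_algebra.
From mathcomp Require Import boolp Rstruct.

Set Implicit Arguments.
Unset Strict Implicit.
Unset Printing Implicit Defensive.

Import Order.TTheory GRing.Theory Num.Theory.

Inductive term : Type :=
  | TVar : nat -> term
  | TConst : R -> term
  | TAdd : term -> term -> term
  | TNeg : term -> term.

Inductive formula : Type :=
  | FEq : term -> term -> formula
  | FLt : term -> term -> formula
  | FInt : term -> formula
  | FNot : formula -> formula
  | FAnd : formula -> formula -> formula
  | FEx : nat -> formula -> formula.

Fixpoint teval (e : nat -> R) (t : term) : R :=
  match t with
  | TVar n => e n
  | TConst c => c
  | TAdd t1 t2 => Rplus (teval e t1) (teval e t2)
  | TNeg t1 => Ropp (teval e t1)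
  end.

Definition upd (e : nat -> R) (n : nat) (a : R) : nat -> R :=
  fun m => if m == n then a else e m.

Fixpoint sat (e : nat -> R) (f : formula) : Prop :=
  match f with
  | FEq t1 t2 => teval e t1 = teval e t2
  | FLt t1 t2 => Rlt (teval e t1) (teval e t2)
  | FInt t => exists z : Z, teval e t = IZR z
  | FNot g => ~ sat e g
  | FAnd g h => sat e g /\ sat e h
  | FEx n g => exists a : R, sat (upd e n a) g
  end.

Definition point (r : nat) (d : 'I_r -> nat) : Type :=
  forall i : 'I_r, 'rV[R]_(d i).

Definition offset (r : nat) (d : 'I_r -> nat) (i : 'I_r) : nat :=
  (\sum_(k < r | (k < i)%N) d k)%N.

Definition point_of_env (r : nat) (d : 'I_r -> nat) (e : nat -> R) : point d :=
  fun i => (\row_(j < d i) e (offset d i + j)%N)%R.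

(* X is definable with parameters in <R,<,+,Z>, coordinates being
   identified with the variables x_0, x_1, ... block by block. *)
Definition definable (r : nat) (d : 'I_r -> nat) (X : point d -> Prop) : Prop :=
  exists phi : formula, forall e : nat -> R, X (point_of_env d e) <-> sat e phi.

(* A finite grid B = B_1 x ... x B_r, each B_i given by a duplicate-free list. *)
Definition fgrid (r : nat) (d : 'I_r -> nat) : Type :=
  forall i : 'I_r, seq 'rV[R]_(d i).

Definition wf_grid (r : nat) (d : 'I_r -> nat) (B : fgrid d) : Prop :=
  forall i : 'I_r, uniq (B i).

Definition in_grid (r : nat) (d : 'I_r -> nat) (B : fgrid d) (p : point d) : Prop :=
  forall i : 'I_r, p i \in B i.

Definition grid_sub (r : nat) (d : 'I_r -> nat) (B : fgrid d) (X : point d -> Prop) : Prop :=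
  forall p : point d, in_grid B p -> X p.

Definition k_grid (r : nat) (d : 'I_r -> nat) (k : nat) (B : fgrid d) : Prop :=
  wf_grid B /\ forall i : 'I_r, size (B i) = k.

Definition k_free (r : nat) (d : 'I_r -> nat) (k : nat) (X : point d -> Prop) : Prop :=
  ~ exists B : fgrid d, k_grid k B /\ grid_sub B X.

Definition card_inter (r : nat) (d : 'I_r -> nat) (X : point d -> Prop) (B : fgrid d) : nat :=
  #|[set f : {dffun forall i : 'I_r, 'I_(size (B i))} |
      `[< X (fun i => nth 0%R (B i) (f i)) >] ]|.

Definition delta (r : nat) (d : 'I_r -> nat) (B : fgrid d) : nat :=
  (\sum_(S : {set 'I_r} | #|S| == r.-1) \prod_(i in S) size (B i))%N.

(* Main.v *)
Require Import Defs.
From Stdlib Require Import Reals.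
From mathcomp Require Import all_boot all_order all_algebra.
From mathcomp Require Import boolp Rstruct.
From mathcomp Require Import zify ring lra.
Import Order.TTheory GRing.Theory Num.Theory.
Local Open Scope ring_scope.

(* Write a real tuple as [m + y] with [m] integral and [y] in [[0, 1)]. A definable set
   becomes a finite union of cells [A x C], with [A] cut out by integral linear
   inequalities and congruences on [m], and [C] by real linear equations and strict
   inequalities on [y]: this class is closed under complement, and under projection by
   Cooper's elimination for [Z] and Ferrante-Rackoff's for [R].

   Consider a cell inside a k-free set, and the directions killed by its equations. If
   some block of coordinates supports no nonzero such direction, the cell is the graph of
   a partial function of the other blocks, so it meets [B] in at most [delta B] points.
   Otherwise every block has a direction, and a point of the cell at distance more than a
   constant [T] from all the integral walls would span a k-grid. Hence on the cell some
   integral inequality [f > 0] can be replaced by one of the equations [f = 1], ...,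
   [f = T], and one concludes by induction on the number of inequalities. *)

Set Implicit Arguments.
Unset Strict Implicit.
Unset Printing Implicit Defensive.

(** * Affine functions of countably many variables *)

Definition update (K : Type) (e : nat -> K) (n : nat) (x : K) : nat -> K :=
  fun i => if i == n then x else e i.

(** A semantic form of affinity, which avoids coefficient vectors: with [e = 0] it makes [f - f 0]
    homogeneous, with [t = 1] additive. *)
Definition affine (K : nzRingType) (f : (nat -> K) -> K) : Prop :=
  forall e u t, f (fun i => e i + t * u i) = f e + t * (f u - f (fun=> 0)).

Record aff (K : nzRingType) := Aff { aff_fun :> (nat -> K) -> K ; affP : affine aff_fun }.

Definition lpart (K : nzRingType) (f : aff K) (u : nat -> K) : K := f u - f (fun=> 0).

Definition unit_env (K : nzRingType) (n : nat) : nat -> K := update (fun=> 0) n 1.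

Definition slope (K : nzRingType) (f : aff K) (n : nat) : K := lpart f (unit_env K n).

Lemma affine_const (K : comNzRingType) (c : K) : affine (fun=> c).
Proof. by move=> e u t; ring. Qed.

Lemma affine_var (K : comNzRingType) (n : nat) : affine (fun e : nat -> K => e n).
Proof. by move=> e u t; ring. Qed.

Lemma affine_add (K : comNzRingType) (f g : aff K) : affine (fun e => f e + g e).
Proof. by move=> e u t; rewrite !affP; ring. Qed.

Lemma affine_scale (K : comNzRingType) (c : K) (f : aff K) : affine (fun e => c * f e).
Proof. by move=> e u t; rewrite affP; ring. Qed.

Lemma affine_update0 (K : comNzRingType) (n : nat) (f : aff K) :
  affine (fun e => f (update e n 0)).
Proof.
move=> e u t; rewrite (_ : update (fun=> 0) n 0 = fun=> 0); last first.
  by apply/funext => i; rewrite /update; case: eqP.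
rewrite -affP; congr (f _); apply/funext => i; rewrite /update.
by case: eqP => // _; ring.
Qed.

Definition aconst (K : comNzRingType) (c : K) : aff K := Aff (affine_const c).
Definition avar (K : comNzRingType) (n : nat) : aff K := Aff (@affine_var K n).
Definition aadd (K : comNzRingType) (f g : aff K) : aff K := Aff (affine_add f g).
Definition ascale (K : comNzRingType) (c : K) (f : aff K) : aff K :=
  Aff (affine_scale c f).
Definition aupdate0 (K : comNzRingType) (n : nat) (f : aff K) : aff K :=
  Aff (affine_update0 n f).

Lemma aff_update (K : comNzRingType) (f : aff K) e n x :
  f (update e n x) = f (update e n 0) + x * slope f n.
Proof.
rewrite -affP; congr (f _); apply/funext => i.
by rewrite /unit_env /update; case: eqP => // _; ring.
Qed.

Lemma lpart_eq (K : comNzRingType) (f : aff K) (e e' : nat -> K) :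
  lpart f (fun i => e i - e' i) = f e - f e'.
Proof.
have := affP f e e' (-1); rewrite /lpart.
rewrite (_ : (fun i => e i + -1 * e' i) = fun i => e i - e' i) => [->|]; first by ring.
by apply/funext => i; ring.
Qed.

Lemma lpart_scale (K : comNzRingType) (f : aff K) (c : K) u :
  lpart f (fun i => c * u i) = c * lpart f u.
Proof.
have := affP f (fun=> 0) u c; rewrite /lpart.
rewrite (_ : (fun i => 0 + c * u i) = fun i => c * u i) => [->|]; first by ring.
by apply/funext => i; ring.
Qed.

Lemma lpart0 (K : comNzRingType) (f : aff K) : lpart f (fun=> 0) = 0.
Proof. by rewrite /lpart subrr. Qed.

Lemma aff_sum (K : comNzRingType) (f : aff K) (I : Type) (s : seq I) (e : nat -> K)
    (t : I -> K) (u : I -> nat -> K) :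
  f (fun n => e n + \sum_(i <- s) t i * u i n) = f e + \sum_(i <- s) t i * lpart f (u i).
Proof.
elim: s => [|i s IHs].
  rewrite big_nil addr0; congr (f _); apply/funext => n; rewrite big_nil; ring.
rewrite big_cons [t i * _ + _]addrC addrA -IHs -affP; congr (f _); apply/funext => n.
rewrite big_cons; ring.
Qed.

(** As [t i] lies between 0 and [k], the direction [u i] lowers [f] by at most [k] times its
    absolute slope. This controls how far a cube of side [k] can leave a half-space. *)
Lemma aff_sum_ge (K : realDomainType) (f : aff K) (I : Type) (s : seq I) (e : nat -> K)
    (t : I -> K) (u : I -> nat -> K) (k : K) :
  (forall i, 0 <= t i <= k) ->
  f e - k * \sum_(i <- s) `|lpart f (u i)|
    <= f (fun n => e n + \sum_(i <- s) t i * u i n).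
Proof.
move=> ht; rewrite aff_sum lerD2l mulr_sumr -sumrN ler_sum // => i _.
have /andP[t0 tk] := ht i.
rewrite lerNl -mulrN; apply: le_trans (_ : t i * `|lpart f (u i)| <= _).
  by rewrite ler_wpM2l // -normrN ler_norm.
by rewrite ler_wpM2r.
Qed.

(** * Disjunctive normal forms *)

(* The environment of a formula is split as [m + y] with [m] integral and [y] valued
   in [[0, 1)]; each atom sees only one of the two parts. The junk modulus 0 is avoided
   by dividing by [N.+1] in [IDvd N f]. *)
Inductive atom : Type :=
  | IPos of aff int
  | IDvd of nat & aff int
  | RPos of aff R
  | REq of aff R.

Definition aholds (m : nat -> int) (y : nat -> R) (a : atom) : Prop :=
  match a with
  | IPos f => 0 < f m
  | IDvd N f => (N.+1%:Z %| f m)%Z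
  | RPos f => 0 < f y
  | REq f => f y = 0
  end.

Definition cholds (m : nat -> int) (y : nat -> R) (c : seq atom) : Prop :=
  List.Forall (aholds m y) c.

(** A property of predicates rather than of syntax, so that closure lemmas compose up to
    equivalence. Here [y] is unrestricted; the range [[0, 1)] enters later. *)
Definition dnf (P : (nat -> int) -> (nat -> R) -> Prop) : Prop :=
  exists L : seq (seq atom), forall m y, P m y <-> List.Exists (cholds m y) L.

Lemma In_mem (T : eqType) (x : T) (s : seq T) : List.In x s <-> x \in s.
Proof.
elim: s => //= a s IHs; rewrite inE; split.
  by case=> [->|/IHs ->]; rewrite ?eqxx ?orbT.
by case/orP => [/eqP->|/IHs]; [left|right].
Qed.

Lemma dnf_ext P Q : (forall m y, P m y <-> Q m y) -> dnf P -> dnf Q.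
Proof. by move=> PQ [L hL]; exists L => m y; rewrite -PQ. Qed.

Lemma dnf_conj c : dnf (fun m y => cholds m y c).
Proof.
exists [:: c] => m y; rewrite List.Exists_cons; split; first by left.
by case=> // /List.Exists_nil.
Qed.

Lemma dnf_atom a : dnf (fun m y => aholds m y a).
Proof.
apply: dnf_ext (dnf_conj [:: a]) => m y.
by rewrite /cholds List.Forall_cons_iff; split=> [[]|].
Qed.

Lemma dnf_true : dnf (fun _ _ => True).
Proof. by apply: dnf_ext (dnf_conj [::]) => m y; split=> // _; constructor. Qed.

Lemma dnf_false : dnf (fun _ _ => False).
Proof. by exists [::] => m y; rewrite List.Exists_nil. Qed.

Lemma dnf_or P Q : dnf P -> dnf Q -> dnf (fun m y => P m y \/ Q m y).
Proof.
by case=> L hL [L' hL']; exists (L ++ L') => m y; rewrite hL hL' List.Exists_app.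
Qed.

Lemma dnf_exists (I : Type) (s : seq I) (P : I -> (nat -> int) -> (nat -> R) -> Prop) :
  (forall i, List.In i s -> dnf (P i)) ->
  dnf (fun m y => exists i, List.In i s /\ P i m y).
Proof.
elim: s => [_|i s IHs h].
  by apply: dnf_ext dnf_false => m y; split=> // -[i []].
apply: dnf_ext (dnf_or (h i _) (IHs _)) => [m y|/=|j js /=]; last 2 first.
- by left.
- by apply: h; right.
split=> [[Pi|[j [js Pj]]]|[j [[<-|js] Pj]]]; first by exists i; split; [left|].
- by exists j; split; [right|].
- by left.
- by right; exists j.
Qed.

Lemma dnf_and P Q : dnf P -> dnf Q -> dnf (fun m y => P m y /\ Q m y).
Proof.
case=> L hL [L' hL'].
apply: (@dnf_ext (fun m y => exists c, List.In c L /\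
    exists c', List.In c' L' /\ cholds m y (c ++ c'))).
  move=> m y; rewrite hL hL' !List.Exists_exists /cholds; split.
    case=> c [cL [c' [c'L' /List.Forall_app[hc hc']]]].
    by split; [exists c|exists c'].
  case=> -[c [cL hc]] [c' [c'L' hc']]; exists c; split=> //; exists c'; split=> //.
  exact/List.Forall_app.
apply: dnf_exists => c _; apply: dnf_exists => c' _; exact: dnf_conj.
Qed.

Lemma dnf_forall (I : Type) (s : seq I) (P : I -> (nat -> int) -> (nat -> R) -> Prop) :
  (forall i, List.In i s -> dnf (P i)) ->
  dnf (fun m y => forall i, List.In i s -> P i m y).
Proof.
elim: s => [_|i s IHs h].
  by apply: dnf_ext dnf_true => m y; split=> // _ i [].
apply: dnf_ext (dnf_and (h i _) (IHs _)) => [m y|/=|j js /=]; last 2 first.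
- by left.
- by apply: h; right.
split=> [[Pi Ps] j [<-//|/Ps//]|Ps]; split; first by apply: Ps; left.
by move=> j js; apply: Ps; right.
Qed.

(** Over the integers [f <= 0] is [0 < 1 - f]; non-divisibility by [N.+1] means that [N.+1] divides
    [f + j] for some [1 <= j <= N]; the real atoms split by trichotomy. *)
Lemma dnf_natom a : dnf (fun m y => ~ aholds m y a).
Proof.
case: a => [f|N f|f|f] /=.
- apply: dnf_ext (dnf_atom (IPos (aadd (aconst 1) (ascale (-1) f)))) => m y /=.
  move: (f m : int) => v; split; lia.
- apply: (@dnf_ext (fun m y => exists j, List.In j (iota 1 N) /\
      aholds m y (IDvd N (aadd f (aconst j%:Z))))); last first.
    by apply: dnf_exists => j _; apply: dnf_atom.
  move=> m y /=; move: (f m : int) => v; split=> [[j [/In_mem]]|].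
    rewrite mem_iota => jN /dvdzP[q hq] /dvdzP[q' hq'].
    have : (q - q') * N.+1%:Z = j%:Z by lia.
    by move: jN => /andP[]; have [?|?] := lerP (q - q') 0; nia.
  move=> h; have h0 := modz_ge0 (v) (isT : N.+1%:Z != 0).
  have h1 := ltz_pmod (v) (isT : 0 < N.+1%:Z).
  have h2 := divz_eq (v) N.+1%:Z.
  have h3 : (v %% N.+1)%Z != 0 by apply/negP => /eqP h3; apply: h; apply/dvdz_mod0P.
  (* The complement of the remainder, at most [N] because the remainder is nonzero. *)
  exists (N.+1 - `|(v %% N.+1)%Z|)%N; split.
    by apply/In_mem; rewrite mem_iota; lia.
  apply/dvdzP; exists ((v %/ N.+1)%Z + 1); lia.
- apply: dnf_ext (dnf_or (dnf_atom (RPos (ascale (-1) f))) (dnf_atom (REq f))) => m y /=.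
  split; first by lra.
  by move=> h; have [||->] := ltgtP (f y) 0; [left; lra|lra|right].
- apply: dnf_ext (dnf_or (dnf_atom (RPos (ascale (-1) f))) (dnf_atom (RPos f))) => m y /=.
  split; first by lra.
  by move=> h; have [||//] := ltgtP (f y) 0; [left; lra|right].
Qed.

Lemma dnf_not P : dnf P -> dnf (fun m y => ~ P m y).
Proof.
case=> L hL.
apply: (@dnf_ext (fun m y => forall c, List.In c L ->
    exists a, List.In a c /\ ~ aholds m y a)).
  move=> m y; rewrite hL List.Exists_exists /cholds; split.
    by move=> h [c [cL /List.Forall_forall hc]]; have [a [/hc]] := h c cL.
  move=> h c cL; apply: contrapT => nex; apply: h; exists c; split=> //.
  by apply/List.Forall_forall => a ac; apply: contrapT => na; apply: nex; exists a.
apply: dnf_forall => c _; apply: dnf_exists => a _; exact: dnf_natom.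
Qed.

(** * Eliminating a real quantifier *)

Lemma exists_max_below (s : seq R) (x : R) :
  (exists l, [/\ l \in s, l < x & forall p, p \in s -> p < x -> p <= l]) \/
  (forall p, p \in s -> x <= p).
Proof.
elim: s => [|a s [[l [ls lx hl]]|IHs]]; first by right.
  left; have [al|la] := lerP a l.
    exists l; split=> // [|p]; first by rewrite inE ls orbT.
    by rewrite inE => /orP[/eqP->//|]; apply: hl.
  have [ax|xa] := ltrP a x.
    exists a; split=> // [|p]; first by rewrite inE eqxx.
    by rewrite inE => /orP[/eqP->//|ps px]; apply: le_trans (hl p ps px) (ltW la).
  exists l; split=> // [|p]; first by rewrite inE ls orbT.
  by rewrite inE => /orP[/eqP->|]; [lra|apply: hl].
have [ax|xa] := ltrP a x; last first.
  by right=> p; rewrite inE => /orP[/eqP->//|/IHs].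
left; exists a; split=> // [|p]; first by rewrite inE eqxx.
by rewrite inE => /orP[/eqP->//|/IHs]; lra.
Qed.

Lemma exists_min_above (s : seq R) (x : R) :
  (exists u, [/\ u \in s, x < u & forall p, p \in s -> x < p -> u <= p]) \/
  (forall p, p \in s -> p <= x).
Proof.
have memN p : p \in s -> - p \in [seq - q | q <- s] by move=> ps; apply: map_f.
have [[l [/mapP[u us ->] ux hl]]|h] := exists_max_below [seq - q | q <- s] (- x).
  left; exists u; split=> // [|p ps xp]; first by rewrite -ltrN2.
  by rewrite -lerN2; apply: hl; [apply: memN|rewrite ltrN2].
by right=> p ps; rewrite -lerN2; apply/h/memN.
Qed.

(* Ferrante-Rackoff: the midpoints of [s], together with the points beyond its ends,
   meet every cell of the partition of the line cut out by [s]. *)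
Lemma same_cut (s : seq R) (x : R) :
  exists x', [\/ x' = 0, exists p, p \in s /\ (x' = p + 1 \/ x' = p - 1)
    | exists p q, [/\ p \in s, q \in s & x' = (p + q) / 2]] /\
  forall p, p \in s -> (p < x') = (p < x) /\ (x' < p) = (x < p).
Proof.
have [xs|xs] := boolP (x \in s).
  (* A point of [s] is the midpoint of itself with itself. *)
  exists x; split=> //; apply: Or33; exists x, x; split=> //; lra.
have nx p : p \in s -> p != x by move=> ps; apply: contraNneq xs => <-.
have [[l [ls lx hl]]|hl] := exists_max_below s x;
  have [[u [us xu hu]]|hu] := exists_min_above s x.
- exists ((l + u) / 2); split=> [|p ps]; first by apply: Or33; exists l, u.
  have [px|xp|/eqP] := ltgtP p x; last by rewrite (negPf (nx _ ps)).
    by have := hl p ps px; split; lra.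
  by have := hu p ps xp; split; lra.
- exists (l + 1); split=> [|p ps]; first by apply: Or32; exists l; split=> //; left.
  have [px|xp|/eqP] := ltgtP p x; last by rewrite (negPf (nx _ ps)).
    by have := hl p ps px; split; lra.
  by have := hu p ps; lra.
- exists (u - 1); split=> [|p ps]; first by apply: Or32; exists u; split=> //; right.
  have [px|xp|/eqP] := ltgtP p x; last by rewrite (negPf (nx _ ps)).
    by have := hl p ps; lra.
  by have := hu p ps xp; split; lra.
- exists 0; split=> [|p ps]; first exact: Or31.
  by case/eqP: (nx p ps); apply/eqP; rewrite eq_le hl // hu.
Qed.

Definition real_forms (a : atom) : seq (aff R) :=
  match a with RPos f => [:: f] | REq f => [:: f] | _ => [::] end.

(* When the slope vanishes the root is the junk value 0, a harmless extra cut point. *)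
Definition aroot (n : nat) (f : aff R) : aff R :=
  ascale (- (slope f n)^-1) (aupdate0 n f).

Definition roots (n : nat) (c : seq atom) : seq (aff R) :=
  List.map (aroot n) (List.flat_map real_forms c).

(** The candidates of [same_cut] as affine forms, so that one finite list serves every [y]. *)
Definition test_points (s : seq (aff R)) : seq (aff R) :=
  aconst 0 :: List.map (fun p => aadd p (aconst 1)) s ++
  List.map (fun p => aadd p (aconst (-1))) s ++
  List.flat_map (fun p => List.map (fun q => ascale 2^-1 (aadd p q)) s) s.

Definition asubst (n : nat) (h f : aff R) : aff R :=
  aadd (aupdate0 n f) (ascale (slope f n) h).

Lemma asubstE n h f y : asubst n h f y = f (update y n (h y)).
Proof. by rewrite aff_update /=; ring. Qed.

Definition real_subst (n : nat) (h : aff R) (a : atom) : atom :=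
  match a with
  | RPos f => RPos (asubst n h f)
  | REq f => REq (asubst n h f)
  | _ => a
  end.

Lemma real_substP n h m y a :
  aholds m y (real_subst n h a) <-> aholds m (update y n (h y)) a.
Proof. by case: a => [f|N f|f|f] //; rewrite /real_subst /aholds asubstE. Qed.

(** The candidate given by [same_cut] lies on the same side as [x] of every root, or on the same
    root, so every form keeps its sign. *)
Lemma test_points_sound n c m y x : cholds m (update y n x) c ->
  exists h, List.In h (test_points (roots n c)) /\ cholds m (update y n (h y)) c.
Proof.
move=> /List.Forall_forall hx; set s := roots n c.
have [x' [hx' cut]] := same_cut (List.map (fun p : aff R => p y) s) x.
have [h [hs hy]] : exists h, List.In h (test_points s) /\ h y = x'.
  case: hx' => [->|[v [/In_mem/List.in_map_iff[p [<- ps]] [->|->]]]|].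
  - by exists (aconst 0); split; [left|].
  - exists (aadd p (aconst 1)); split=> //; right; apply/List.in_or_app; left.
    exact: (List.in_map (fun p => aadd p (aconst 1))).
  - exists (aadd p (aconst (-1))); split=> //; right.
    apply/List.in_or_app; right; apply/List.in_or_app; left.
    exact: (List.in_map (fun p => aadd p (aconst (-1)))).
  - case=> [v [w [/In_mem/List.in_map_iff[p [<- ps]] /In_mem/List.in_map_iff[q [<- qs]] ->]]].
    exists (ascale 2^-1 (aadd p q)); split; last by rewrite /= mulrC.
    right; apply/List.in_or_app; right; apply/List.in_or_app; right.
    apply/List.in_flat_map; exists p; split=> //.
    exact: (List.in_map (fun q => ascale 2^-1 (aadd p q))).
exists h; split=> //; rewrite hy; apply/List.Forall_forall => a ac.
have key f : List.In f (real_forms a) ->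
    (0 < f (update y n x) -> 0 < f (update y n x')) /\
    (f (update y n x) = 0 -> f (update y n x') = 0).
  move=> fa; rewrite (aff_update f y n x) (aff_update f y n x').
  case: (eqVneq (slope f n) 0) => [->|s0].
    by rewrite !mulr0.
  have ps : List.In (aroot n f) s.
    by apply: List.in_map; apply/List.in_flat_map; exists a.
  have /cut[] : aroot n f y \in List.map (fun p : aff R => p y) s.
    by apply/In_mem; apply: (List.in_map (fun p : aff R => p y)).
  (* This gives [f] the value [slope f n] times the difference of the variable and the root. *)
  have -> : f (update y n 0) = - aroot n f y * slope f n.
    by rewrite /= !mulNr opprK mulrAC mulVf // mul1r.
  move: (aroot n f y) => p; rewrite -!mulrDl => h1 h2; split.
    have [s1|s1] : slope f n < 0 \/ 0 < slope f n by apply/orP; rewrite -neq_lt.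
      by rewrite !nmulr_lgt0 //; lra.
    by rewrite !pmulr_lgt0 //; lra.
  move=> /eqP; rewrite mulf_eq0 (negPf s0) orbF addrC subr_eq0 => /eqP xp.
  move: h1 h2; rewrite -xp ltxx => /negbT + /negbT; rewrite -!leNgt => h1 h2.
  by apply/eqP; rewrite mulf_eq0; apply/orP; left; lra.
move: (hx a ac) key; case: a {ac} => [f|N f|f|f] //= hf key.
- by have [h1 _] := key f (or_introl erefl); apply: h1.
- by have [_ h1] := key f (or_introl erefl); apply: h1.
Qed.

Lemma dnf_ex_real n P : dnf P -> dnf (fun m y => exists x, P m (update y n x)).
Proof.
case=> L hL; apply: (@dnf_ext (fun m y => exists c, List.In c L /\
    exists h, List.In h (test_points (roots n c)) /\
      cholds m y (List.map (real_subst n h) c))); last first.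
  by apply: dnf_exists => c _; apply: dnf_exists => h _; apply: dnf_conj.
have substP m y h c :
    cholds m y (List.map (real_subst n h) c) <-> cholds m (update y n (h y)) c.
  rewrite /cholds List.Forall_map !List.Forall_forall.
  by split=> H a /H /real_substP.
move=> m y; split=> [[c [cL [h [_ /substP hc]]]]|[x]].
  by exists (h y); apply/hL/List.Exists_exists; exists c.
move=> /hL/List.Exists_exists[c [cL /test_points_sound[h [hs hc]]]].
by exists c; split=> //; exists h; split=> //; apply/substP.
Qed.

(** * Eliminating an integer quantifier *)

(** [A.+1 * f] with [t] in place of [A.+1] times the variable [n]: the factor clears the denominator
    of [t / A.+1]. *)
Definition int_subst_form (n A : nat) (t f : aff int) : aff int :=
  aadd (ascale A.+1%:Z (aupdate0 n f)) (ascale (slope f n) t).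

(* Substitutes [t / A.+1] for the variable [n]. *)
Definition int_subst (n A : nat) (t : aff int) (a : atom) : atom :=
  match a with
  | IPos f => IPos (int_subst_form n A t f)
  | IDvd N f => IDvd (A.+1 * N.+1).-1 (int_subst_form n A t f)
  | _ => a
  end.

Lemma int_substP n A (t : aff int) m y (x : int) a : A.+1%:Z * x = t m ->
  aholds m y (int_subst n A t a) <-> aholds (update m n x) y a.
Proof.
move=> tx.
have E f : int_subst_form n A t f m = A.+1%:Z * f (update m n x).
  by rewrite aff_update /= -tx; ring.
case: a => [f|N f|f|f] //; rewrite /int_subst /aholds E; first by rewrite pmulr_rgt0.
by rewrite prednK // PoszM dvdz_mul2l.
Qed.

(** The equation leaves the single candidate [t / A.+1], an integer exactly when [A.+1] divides
    [t]. *)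
Lemma dnf_ex_int_eq n A (t : aff int) c :
  dnf (fun m y => exists x, A.+1%:Z * x = t m /\ cholds (update m n x) y c).
Proof.
apply: dnf_ext (dnf_conj (IDvd A t :: List.map (int_subst n A t) c)) => m y.
rewrite /cholds List.Forall_cons_iff List.Forall_map !List.Forall_forall; split.
  case=> /dvdzP[x tx] hc; exists x; rewrite mulrC; split=> //.
  apply/List.Forall_forall => a ac; apply/int_substP; last exact: hc ac.
  by rewrite mulrC.
case=> x [tx /List.Forall_forall hc]; split; first by rewrite /= -tx dvdz_mulr.
by move=> a ac; apply/int_substP; [exact: tx|apply: hc].
Qed.

Definition modulus (a : atom) : nat := if a is IDvd N _ then N.+1 else 1.

(** A common multiple of the moduli; the product serves as well as the least one. *)
Fixpoint period (c : seq atom) : nat :=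
  if c is a :: c' then (modulus a * period c')%N else 1%N.

Lemma modulus_gt0 a : (0 < modulus a)%N.
Proof. by case: a. Qed.

Lemma period_gt0 c : (0 < period c)%N.
Proof. by elim: c => //= a c IHc; rewrite muln_gt0 modulus_gt0. Qed.

Lemma dvdn_period a c : List.In a c -> (modulus a %| period c)%N.
Proof.
by elim: c => //= b c IHc [->|/IHc h]; [rewrite dvdn_mulr|rewrite dvdn_mull].
Qed.

Definition bounded_below (n : nat) (a : atom) : bool :=
  if a is IPos f then 0 < slope f n else false.

Lemma aholds_shift_down n m y x (p t : nat) a :
  (modulus a %| p)%N -> ~~ bounded_below n a ->
  aholds (update m n x) y a -> aholds (update m n (x - t%:Z * p%:Z)) y a.
Proof.
case: a => [f|N f|f|f] //=; rewrite (aff_update f m n x) (aff_update f m n (x - _)).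
  move: (slope f n : int) (f (update m n 0) : int) => s v _; nia.
move=> Np _ fx; rewrite mulrBl addrA rpredB // dvdz_mulr // dvdz_mull //.
Qed.

(** Cooper's descent: subtract the period as long as [c] holds. Only a lower bound [f] can fail at
    the next step, and that step lowers [f] by [slope f n * period c], so [f] was at most this
    before it. *)
Lemma int_descent n m y x c : (exists2 a, List.In a c & bounded_below n a) ->
  cholds (update m n x) y c ->
  exists x' f, [/\ cholds (update m n x') y c, List.In (IPos f) c, 0 < slope f n
    & 1 <= f (update m n x') <= slope f n * (period c)%:Z].
Proof.
case=> -[f0|//|//|//] f0c /= s0 hc; set p := period c.
have p0 : (0 < p)%N := period_gt0 c.
pose Q t := `[< ~ cholds (update m n (x - t%:Z * p%:Z)) y c >].
have exQ : exists t, Q t.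
  (* Each step lowers [f0] by at least 1, so after this many it is no longer positive. *)
  exists `|f0 (update m n x)|%N; apply/asboolP => /List.Forall_forall /(_ _ f0c) /=.
  rewrite (aff_update f0 m n x) (aff_update f0 m n (x - _)).
  move: s0; move: (slope f0 n : int) (f0 (update m n 0) : int) => s v s0.
  rewrite mulrBl addrA -mulrA; move: (v + x * s) => w.
  have : 1 <= p%:Z * s by nia.
  by move: (p%:Z * s) => q; nia.
have hQ0 : ~~ Q 0%N by apply/negP => /asboolP; rewrite mul0r subr0.
(* Step 0 does not fail, so the first failure is some [t.+1] and [c] still holds after [t] steps. *)
case: (ex_minnP exQ) => -[|t] Qt mint; first by rewrite Qt in hQ0.
have ht : cholds (update m n (x - t%:Z * p%:Z)) y c.
  by apply: contrapT => /asboolP /mint; rewrite ltnn.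
move/asboolP: Qt => Qt.
have [a [ac na]] : exists a, List.In a c /\
    ~ aholds (update m n (x - t.+1%:Z * p%:Z)) y a.
  apply: contrapT => nex; apply: Qt; apply/List.Forall_forall => a ac.
  by apply: contrapT => na; apply: nex; exists a.
have ha : aholds (update m n (x - t%:Z * p%:Z)) y a by move/List.Forall_forall: ht; apply.
have xE : x - t.+1%:Z * p%:Z = x - t%:Z * p%:Z - 1%N%:Z * p%:Z by lia.
have ba : bounded_below n a.
  apply/negPn/negP => nba; apply: na; rewrite xE; apply: aholds_shift_down => //.
  exact: dvdn_period.
case: a ac na ha ba => [f|//|//|//] fc /= nf hf sf.
exists (x - t%:Z * p%:Z), f; split=> //; move: nf hf; rewrite xE.
move: (x - _) => {ht exQ hQ0 Qt hc xE mint} x'.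
rewrite (aff_update f m n x') (aff_update f m n (x' - _)).
by move: sf; move: (slope f n : int) (f (update m n 0) : int) => s v; lia.
Qed.

(* An atom bounding the variable [n] from above is vacuous near minus infinity. *)
Definition int_at_minf (n : nat) (j : int) (a : atom) : atom :=
  if a is IPos f then
    if slope f n < 0 then IPos (aconst 1) else int_subst n 0 (aconst j) a
  else int_subst n 0 (aconst j) a.

(** Without lower bounds one can go to minus infinity in steps of the period: there the upper bounds
    are vacuous, and the other atoms depend only on the residue of [x]. *)
Lemma int_minf n m y c : (forall a, List.In a c -> ~~ bounded_below n a) ->
  (exists x, cholds (update m n x) y c) <->
  exists j, List.In j (iota 0 (period c)) /\
    cholds m y (List.map (int_at_minf n j%:Z) c).
Proof.
move=> nb; have p0 := period_gt0 c; split=> [[x hc]|[j [_ hc]]].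
  exists `|(x %% period c)%Z|%N; split.
    apply/In_mem; rewrite mem_iota /=.
    have := modz_ge0 x (isT : (period c).-1.+1%:Z != 0).
    have := ltz_pmod x (isT : 0 < (period c).-1.+1%:Z).
    by rewrite prednK //; lia.
  rewrite gez0_abs; last by apply: modz_ge0; lia.
  apply/List.Forall_map/List.Forall_forall => a ac.
  have {hc} : aholds (update m n x) y a by move/List.Forall_forall: hc; apply.
  have dv := dvdn_period ac.
  have j1 : 1%:Z * (x %% period c)%Z = aconst (x %% period c)%Z m by rewrite mul1r.
  have xE : (x %% period c)%Z = x - (x %/ period c)%Z * (period c)%:Z.
    by rewrite {2}(divz_eq x (period c)); ring.
  case: a ac dv => [f|N f|f|f] ac dv hf //.
    rewrite /int_at_minf; case: ifP => // /negbT; rewrite -leNgt => s1.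
    apply/(int_substP n y _ j1) => /=.
    have s2 : slope f n = 0.
      by apply/eqP; rewrite eq_le s1 andbT leNgt; apply: nb ac.
    by move: hf; rewrite /= (aff_update f m n x) (aff_update f m n (x %% _)%Z) s2 !mulr0.
  apply/(int_substP n y _ j1); move: hf => /=.
  rewrite (aff_update f m n x) (aff_update f m n (x %% _)%Z) => hf.
  rewrite xE mulrBl addrA rpredB // dvdz_mulr // dvdz_mull //.
(* The residue [j] itself may violate upper bounds, but [c] holds from some number of downward steps
   on. *)
have [t0 ht0] : exists t0 : nat, forall t, (t0 <= t)%N ->
    cholds (update m n (j%:Z - t%:Z * (period c)%:Z)) y c.
  move: hc nb; have dv a : List.In a c -> (modulus a %| period c)%N by apply: dvdn_period.
  (* For the induction on [c], the step [p] is only remembered to be a positive multiple of all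
     moduli. *)
  move: (period c) p0 dv => p p0; elim: c => [|a c IHc] dv /=.
    by move=> _ _; exists 0%N => t _; constructor.
  move=> /List.Forall_cons_iff[ha hc] nb.
  have [t1 ht1] : exists t0, forall t, (t0 <= t)%N ->
    cholds (update m n (j%:Z - t%:Z * p%:Z)) y c.
    by apply: IHc => // b bc; [apply: dv|apply: nb]; right.
  have nba := nb a (or_introl erefl); have dva := dv a (or_introl erefl).
  have [t2 ht2] : exists t0, forall t, (t0 <= t)%N ->
    aholds (update m n (j%:Z - t%:Z * p%:Z)) y a.
    have j1 : 1%:Z * j%:Z = aconst j%:Z m by rewrite mul1r.
    have easy : aholds m y (int_subst n 0 (aconst j%:Z) a) -> exists t0, forall t,
        (t0 <= t)%N -> aholds (update m n (j%:Z - t%:Z * p%:Z)) y a.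
      move=> /(int_substP n y a j1) h; exists 0%N => t _.
      exact: aholds_shift_down.
    case: a {nb dv dva} nba ha easy => [f|N f|f|f] _ ha easy;
      rewrite /= in ha; try exact: easy.
    case: ifP ha => [s0 _|_ ha]; last exact: easy.
    (* With negative slope, each step down raises [f] by at least 1. *)
    exists (`|f (update m n j%:Z)|%N + 1)%N => t /=.
    rewrite (aff_update f m n j) (aff_update f m n (j%:Z - _)).
    move: s0; move: (slope f n : int) (f (update m n 0) : int) => s v s0.
    rewrite mulrBl addrA -mulrA; move: (v + j%:Z * s) => w.
    have : p%:Z * s <= -1 by nia.
    by move: (p%:Z * s) => q; nia.
  exists (t1 + t2)%N => t ht; constructor; [apply: ht2|apply: ht1]; lia.
by exists (j%:Z - t0%:Z * (period c)%:Z); apply: ht0.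
Qed.

(** If some atom bounds the variable below, [int_descent] reduces the search to finitely many
    equations [f = j] with [1 <= j <= slope f n * period c]; otherwise [int_minf] applies. *)
Lemma dnf_ex_int_conj n c : dnf (fun m y => exists x, cholds (update m n x) y c).
Proof.
have [hb|nb] := pselect (exists2 a, List.In a c & bounded_below n a); last first.
  apply: (@dnf_ext (fun m y => exists j, List.In j (iota 0 (period c)) /\
      cholds m y (List.map (int_at_minf n j%:Z) c))).
    move=> m y; rewrite int_minf // => a ac.
    by apply/negP => ba; apply: nb; exists a.
  by apply: dnf_exists => j _; apply: dnf_conj.
(* [slope f n * x = rest f j] is the equation [f = j] solved for the variable [n]. *)
pose rest (f : aff int) (j : nat) := aadd (aconst j%:Z) (ascale (-1) (aupdate0 n f)).
apply: (@dnf_ext (fun m y => exists a, List.In a c /\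
    if a is IPos f then
      if 0 < slope f n then
        exists j, List.In j (iota 1 (`|slope f n| * period c)%N) /\
          exists x, (`|slope f n|%N.-1.+1)%:Z * x = rest f j m /\
             cholds (update m n x) y c
      else False
    else False)); last first.
  apply: dnf_exists => -[f|N f|f|f] _; try exact: dnf_false.
  case: (0 < slope f n); last exact: dnf_false.
  by apply: dnf_exists => j _; apply: dnf_ex_int_eq.
move=> m y; split=> [[[f|N f|f|f] [_] //]|[x]].
  by case: ifP => // _ [j [_ [x [_ hx]]]]; exists x.
move=> /(int_descent hb)[x' [f [hx' fc sf hf]]]; exists (IPos f); split=> //.
rewrite sf; exists `|f (update m n x')|%N; move: sf hf; rewrite (aff_update f m n x').
rewrite /rest /=; move: (slope f n : int) (f (update m n 0) : int) => s v s0 /andP[h1 h2].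
split; first by apply/In_mem; rewrite mem_iota; lia.
exists x'; split=> //; have -> : (`|s|%N.-1.+1)%:Z = s by lia.
by rewrite gez0_abs; [ring|lia].
Qed.

Lemma dnf_ex_int n P : dnf P -> dnf (fun m y => exists x, P (update m n x) y).
Proof.
case=> L hL; apply: (@dnf_ext (fun m y => exists c, List.In c L /\
    exists x, cholds (update m n x) y c)); last first.
  by apply: dnf_exists => c _; apply: dnf_ex_int_conj.
move=> m y; split=> [[c [cL [x hx]]]|[x]].
  by exists x; apply/hL/List.Exists_exists; exists c.
by move=> /hL/List.Exists_exists[c [cL hx]]; exists c; split=> //; exists x.
Qed.

(** * Definable sets *)

Definition join_env (m : nat -> int) (y : nat -> R) : nat -> R :=
  fun n => (m n)%:~R + y n.

Definition frac_env (y : nat -> R) : Prop := forall n, 0 <= y n < 1.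

Lemma IZR_int (x : R) : (exists z : Z, x = IZR z) <-> exists j : int, x = j%:~R.
Proof.
split=> [[z ->]|[j ->]].
  have [hz|hz] := Z.le_ge_cases 0 z.
    exists (Posz (Z.to_nat z)).
    by rewrite -[in LHS](Znat.Z2Nat.id _ hz) -INR_IZR_INZ INRE.
  have hz' : Z.le 0 (Z.opp z) by lia.
  exists (- Posz (Z.to_nat (Z.opp z))).
  rewrite -[in LHS](Z.opp_involutive z) opp_IZR -[in LHS](Znat.Z2Nat.id _ hz').
  by rewrite -INR_IZR_INZ INRE mulrNz.
case: j => n.
  by exists (Z.of_nat n); rewrite -INR_IZR_INZ INRE.
exists (Z.opp (Z.of_nat n.+1)).
by rewrite opp_IZR -INR_IZR_INZ INRE NegzE mulrNz.
Qed.

Lemma floor_frac (x : R) :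
  exists (j : int) (z : R), x = j%:~R + z /\ 0 <= z < 1.
Proof.
exists (Num.floor x), (x - (Num.floor x)%:~R); split; first by ring.
by have := floor_itv x; rewrite intrD; lra.
Qed.

Lemma floor_frac_unique (j j' : int) (z z' : R) :
  0 <= z < 1 -> 0 <= z' < 1 -> j%:~R + z = j'%:~R + z' -> j = j' /\ z = z'.
Proof.
move=> hz hz' E.
have h1 : (j - j')%:~R < (1%:~R : R) by rewrite intrB; lra.
have h2 : (j' - j)%:~R < (1%:~R : R) by rewrite intrB; lra.
move: h1 h2; rewrite !ltr_int => h1 h2.
have jj : j = j' by lia.
by split=> //; move: E; rewrite jj; lra.
Qed.

Lemma join_env_exists (e : nat -> R) : exists m y, e = join_env m y /\ frac_env y.
Proof.
have [g hg] := choice (fun n => floor_frac (e n)).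
have [y hy] := choice hg.
exists g, y; split=> [|n]; last by case: (hy n).
by apply/funext => n; case: (hy n).
Qed.

(** Addition and negation do not mix the two parts, and real constants go to the real one. The bound
    [M] leaves finitely many values for the floor of the real part, so a disjunction can enumerate
    them. *)
Lemma term_split (t : term) : exists (g : aff int) (h : aff R) (M : nat),
  forall m y, frac_env y ->
    teval (join_env m y) t = (g m)%:~R + h y /\ `|h y| <= M%:R.
Proof.
elim: t => [n|c|t1 [g1 [h1 [M1 IH1]]] t2 [g2 [h2 [M2 IH2]]]|t [g [h [M IH]]]].
- exists (avar _ n), (avar _ n), 1%N => m y hy; split=> //=.
  by have /andP[y0 y1] := hy n; rewrite ger0_norm // ltW.
- exists (aconst 0), (aconst c), (Num.bound `|c|) => m y hy /=.
  by rewrite add0r ltW // archi_boundP // normr_ge0.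
- exists (aadd g1 g2), (aadd h1 h2), (M1 + M2)%N => m y hy /=.
  have [-> b1] := IH1 m y hy; have [-> b2] := IH2 m y hy; split.
    by rewrite intrD RplusE; ring.
  by rewrite natrD; apply: le_trans (ler_normD _ _) _; apply: lerD.
- exists (ascale (-1) g), (ascale (-1) h), M => m y hy /=.
  have [-> b] := IH m y hy; split; last by rewrite mulN1r normrN.
  by rewrite RoppE intrM; ring.
Qed.

(** The integers from [- M.+1] to [M], which include the floor of every real of absolute value at
    most [M]. *)
Definition int_range (M : nat) : seq int :=
  [seq i%:Z - M.+1%:Z | i <- iota 0 (M.+1 + M.+1)].

Lemma mem_int_range (M : nat) (j : int) (z : R) :
  `|z| <= M%:R -> 0 <= z - j%:~R < 1 -> List.In j (int_range M).
Proof.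
rewrite ler_norml => zM zj.
have h1 : (j%:~R : R) <= M%:Z%:~R by rewrite -[M%:Z%:~R]/(M%:R); lra.
have h2 : (- M%:Z)%:~R < ((j + 1)%:~R : R).
  by rewrite intrD mulrNz -[M%:Z%:~R]/(M%:R); lra.
move: h1 h2; rewrite ler_int ltr_int => h1 h2.
apply/In_mem/mapP; exists (absz (j + M.+1%:Z)); first by rewrite mem_iota; lia.
by lia.
Qed.

Lemma sat_dnf (phi : formula) : exists P, dnf P /\
  forall m y, frac_env y -> (sat (join_env m y) phi <-> P m y).
Proof.
elim: phi => [t1 t2|t1 t2|t|phi [P [dP hP]]|phi [P [dP hP]] psi [Q [dQ hQ]]|
  n phi [P [dP hP]]].
- have [g [h [M ht]]] := term_split (TAdd t1 (TNeg t2)).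
  (* [g + h = 0] means that [h] is an integer [j] and [g + j] is neither positive nor negative. *)
  exists (fun m y => exists j, List.In j (int_range M) /\
    (aholds m y (REq (aadd h (aconst (- j%:~R)))) /\
     (~ aholds m y (IPos (aadd g (aconst j))) /\
      ~ aholds m y (IPos (ascale (-1) (aadd g (aconst j))))))); split.
    apply: dnf_exists => j _; apply: dnf_and; first exact: dnf_atom.
    by apply: dnf_and; apply: dnf_natom.
  move=> m y hy; have [/= E bE] := ht m y hy.
  have -> : teval (join_env m y) t1 = teval (join_env m y) t2 <-> (g m)%:~R + h y = 0.
    by rewrite -E RplusE RoppE; split; lra.
  move: (g m : int) (h y) bE => v z bz; split.
    move=> vz; exists (- v); split; first by apply: mem_int_range bz _; rewrite mulrNz; lra.
    by split; [rewrite mulrNz; lra|split; lia].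
  case=> j [_ [zj [h1 h2]]]; have -> : v = - j by lia.
  by rewrite mulrNz; lra.
- have [g [h [M ht]]] := term_split (TAdd t2 (TNeg t1)).
  (* For [j] the floor of [h], [0 < g + h] means [0 < g + j] when [h = j], and [0 <= g + j], written
     [0 < g + (j + 1)], when [h > j]. *)
  exists (fun m y => exists j, List.In j (int_range M) /\
    ((aholds m y (REq (aadd h (aconst (- j%:~R)))) /\
        aholds m y (IPos (aadd g (aconst j)))) \/
     (aholds m y (RPos (aadd h (aconst (- j%:~R)))) /\
       (aholds m y (RPos (aadd (aconst (j + 1)%:~R) (ascale (-1) h))) /\
        aholds m y (IPos (aadd g (aconst (j + 1)))))))); split.
    apply: dnf_exists => j _; apply: dnf_or; apply: dnf_and; try exact: dnf_atom.
    by apply: dnf_and; apply: dnf_atom.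
  move=> m y hy; have [/= E bE] := ht m y hy.
  have -> : Rlt (teval (join_env m y) t1) (teval (join_env m y) t2)
      <-> 0 < (g m)%:~R + h y.
    rewrite -E RplusE RoppE; split; first by move/RltP; lra.
    by move=> h0; apply/RltP; lra.
  move: (g m : int) (h y) bE => v z bz; split.
    move=> vz; have [j [x [zE hx]]] := floor_frac z; exists j; split.
      by apply: mem_int_range bz _; lra.
    have [x0|x0] : x = 0 \/ 0 < x by have [||] := ltgtP x 0; [lra|right|left].
      left; split; first by lra.
      have : 0 < (v + j)%:~R :> R by rewrite intrD; lra.
      by rewrite ltr0z.
    right; split; [by lra|split; [by rewrite intrD; lra|]].
    have : 0 < (v + (j + 1))%:~R :> R by rewrite !intrD; lra.
    by rewrite ltr0z.
  case=> j [_ [[zj vj]|[zj [zj1 vj]]]].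
    have : 0 < (v + j)%:~R :> R by rewrite ltr0z.
    by rewrite intrD; lra.
  have : 0 <= (v + j)%:~R :> R by rewrite ler0z; lia.
  by rewrite intrD; lra.
- have [g [h [M ht]]] := term_split t.
  exists (fun m y => exists j, List.In j (int_range M) /\
    aholds m y (REq (aadd h (aconst (- j%:~R))))); split.
    by apply: dnf_exists => j _; apply: dnf_atom.
  move=> m y hy; have [E bE] := ht m y hy; rewrite [sat _ _]IZR_int E /=.
  move: (g m : int) (h y) bE => v z bz; split=> [[j zj]|[j [_ zj]]].
    have zE : z = (j - v)%:~R by rewrite intrB; lra.
    exists (j - v); split; last by rewrite zE subrr.
    by apply: mem_int_range bz _; rewrite -zE; lra.
  by exists (v + j); rewrite intrD; lra.
- exists (fun m y => ~ P m y); split; first exact: dnf_not.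
  by move=> m y hy /=; rewrite hP.
- exists (fun m y => P m y /\ Q m y); split; first exact: dnf_and.
  by move=> m y hy /=; rewrite hP // hQ.
(* A real quantifier becomes one over an integer and one over a fractional part, whose bounds are
   added as literals. *)
- pose Q m y := P m y /\ (~ aholds m y (RPos (ascale (-1) (avar _ n))) /\
    aholds m y (RPos (aadd (aconst 1) (ascale (-1) (avar _ n))))).
  exists (fun m y => exists x z, Q (update m n x) (update y n z)); split.
    apply: (@dnf_ex_int n (fun m y => exists z, Q m (update y n z))).
    apply: dnf_ex_real; apply: dnf_and => //.
    by apply: dnf_and; [apply: dnf_natom|apply: dnf_atom].
  have joinE m y x z : join_env (update m n x) (update y n z)
      = upd (join_env m y) n (x%:~R + z).
    by apply/funext => i; rewrite /join_env /update /upd; case: eqP.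
  have fracE y z : frac_env y -> 0 <= z < 1 -> frac_env (update y n z).
    by move=> hy hz i; rewrite /update; case: eqP.
  move=> m y hy; rewrite /Q /= /update eqxx; split=> [[a]|[x [z [hPz hz]]]].
    have [x [z [-> hz]]] := floor_frac a.
    rewrite -joinE => /hP hPz; exists x, z; split; last by split; lra.
    exact/hPz/fracE.
  exists (x%:~R + z); rewrite -joinE; apply/hP; last exact: hPz.
  by apply: fracE => //; apply/andP; split; case: hz => h1 h2; lra.
Qed.

(** * Coordinates of points *)

Definition coord (r : nat) (d : 'I_r -> nat) : finType := {i : 'I_r & 'I_(d i)}.

Definition pos (r : nat) (d : 'I_r -> nat) (s : coord d) : nat :=
  (offset d (tag s) + tagged s)%N.

Lemma offset_add (r : nat) (d : 'I_r -> nat) (i j : 'I_r) :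
  (i < j)%N -> (offset d i + d i <= offset d j)%N.
Proof.
move=> ij; rewrite /offset [leqRHS](bigD1 i) //= addnC leq_add2l.
rewrite [leqRHS](bigID (fun k : 'I_r => k < i)%N) /=.
apply: leq_trans (leq_addr _ _); apply: eq_leq; apply: eq_bigl => k.
have [ki|] := boolP (k < i)%N; last by rewrite andbF.
by rewrite (ltn_trans ki ij) andbT /=; apply/esym/eqP => E; rewrite E ltnn in ki.
Qed.

Lemma pos_inj (r : nat) (d : 'I_r -> nat) : injective (@pos r d).
Proof.
move=> [i a] [j b]; rewrite /pos /= => E.
have aux (i' j' : 'I_r) (a' : 'I_(d i')) (b' : 'I_(d j')) :
    (i' < j')%N -> (offset d i' + a' < offset d j' + b')%N.
  move=> ij; apply: leq_trans (leq_addr _ _); apply: leq_trans (offset_add d ij).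
  by rewrite ltn_add2l.
have [ij|ij|/val_inj ij] := ltngtP i j.
- by have := aux _ _ a b ij; rewrite E ltnn.
- by have := aux _ _ b a ij; rewrite E ltnn.
- by case: _ / ij b E => b /addnI /val_inj ->.
Qed.

(** Variables that number no coordinate get the default 0, so all points agree there. *)
Definition env_of (r : nat) (d : 'I_r -> nat) (p : point d) (n : nat) : R :=
  if [pick s : coord d | pos s == n] is Some s then p (tag s) 0 (tagged s) else 0.

Lemma env_of_pos (r : nat) (d : 'I_r -> nat) (p : point d) (s : coord d) :
  env_of p (pos s) = p (tag s) 0 (tagged s).
Proof.
rewrite /env_of; case: pickP => [s' /eqP /pos_inj -> //|/(_ s)].
by rewrite eqxx.
Qed.

Lemma env_of_out (r : nat) (d : 'I_r -> nat) (p : point d) (n : nat) :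
  (forall s : coord d, pos s <> n) -> env_of p n = 0.
Proof. by move=> h; rewrite /env_of; case: pickP => [s /eqP /h|]. Qed.

Lemma env_ofK (r : nat) (d : 'I_r -> nat) (p : point d) : point_of_env d (env_of p) = p.
Proof.
apply: functional_extensionality_dep => i; apply/rowP => j; rewrite mxE.
exact: (env_of_pos p (Tagged (fun i => 'I_(d i)) j)).
Qed.

Lemma posP (r : nat) (d : 'I_r -> nat) (n : nat) :
  (exists s : coord d, pos s = n) \/ (forall s : coord d, pos s <> n).
Proof.
have [[s h]|h] := pselect (exists s : coord d, pos s = n); first by left; exists s.
by right=> s E; apply: h; exists s.
Qed.

(** An index that numbers no coordinate at all counts as off every block. *)
Definition off_block (r : nat) (d : 'I_r -> nat) (i : 'I_r) (n : nat) : Prop :=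
  forall s : coord d, pos s = n -> tag s <> i.

(** * Zarankiewicz bounds *)

(** The bound is separated from k-freeness, so that it passes to subsets and finite unions. *)
Definition zar (r : nat) (d : 'I_r -> nat) (X : point d -> Prop) : Prop :=
  exists a : nat, forall B : fgrid d, wf_grid B -> (card_inter X B <= a * delta B)%N.

Lemma zar_sub (r : nat) (d : 'I_r -> nat) (X Y : point d -> Prop) :
  (forall p, X p -> Y p) -> zar Y -> zar X.
Proof.
move=> XY [a ha]; exists a => B wB; apply: leq_trans (ha B wB).
apply: subset_leq_card; apply/subsetP => f; rewrite !inE => /asboolP /XY h.
exact/asboolP.
Qed.

Lemma k_free_sub (r : nat) (d : 'I_r -> nat) (k : nat) (X Y : point d -> Prop) :
  (forall p, X p -> Y p) -> k_free k Y -> k_free k X.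
Proof. by move=> XY kY [B [kB BX]]; apply: kY; exists B; split=> // p /BX /XY. Qed.

Lemma zar_empty (r : nat) (d : 'I_r -> nat) (X : point d -> Prop) :
  (forall p, ~ X p) -> zar X.
Proof.
move=> X0; exists 0%N => B wB; rewrite leqn0 cards_eq0; apply/eqP/setP => f.
by rewrite !inE; apply/asboolP.
Qed.

Lemma zar_exists (r : nat) (d : 'I_r -> nat) (I : Type) (s : seq I)
    (X : I -> point d -> Prop) :
  (forall i, List.In i s -> zar (X i)) ->
  zar (fun p => exists i, List.In i s /\ X i p).
Proof.
elim: s => [_|i s IHs h]; first by apply: zar_empty => p [i []].
have [a ha] := h i (or_introl erefl).
have [b hb] : zar (fun p => exists i, List.In i s /\ X i p).
  by apply: IHs => j js; apply: h; right.
exists (a + b)%N => B wB; rewrite mulnDl.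
apply: leq_trans (leq_add (ha B wB) (hb B wB)); rewrite /card_inter.
apply: leq_trans (leq_card_setU _ _); apply: subset_leq_card; apply/subsetP => f.
rewrite !inE => /asboolP [j [/= [<-|js] hj]]; apply/orP; [left|right].
  exact/asboolP.
by apply/asboolP; exists j.
Qed.

(** The product is the summand of [delta B] at the complement of [i]. *)
Lemma prod_le_delta (r : nat) (d : 'I_r -> nat) (B : fgrid d) (i : 'I_r) :
  (\prod_(j | j != i) size (B j) <= delta B)%N.
Proof.
rewrite /delta (bigD1 (setC [set i])) /=; last by rewrite cardsC1 card_ord.
apply: leq_trans (leq_addr _ _); apply: eq_leq; apply: eq_bigl => j.
by rewrite !inE.
Qed.

(** Forgetting block [i] is injective on [X], so the points in [B] number at most the product of the
    other sizes. *)
Lemma zar_inj (r : nat) (d : 'I_r -> nat) (X : point d -> Prop) (i : 'I_r) :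
  (forall p q, X p -> X q -> (forall j, j != i -> p j = q j) -> p = q) -> zar X.
Proof.
move=> inj; exists 1%N => B wB; rewrite mul1n; apply: leq_trans (prod_le_delta B i).
rewrite /card_inter; set A := finset _.
have [->|[f0 f0A]] := set_0Vmem A; first by rewrite cards0.
pose F j : pred 'I_(size (B j)) := fun x => (j != i) || (x == f0 j).
(* Block [i] is forgotten by freezing its index at that of [f0], which stays in the same dependent
   function type and lands in the box [F]. *)
pose proj (f : {dffun forall j : 'I_r, 'I_(size (B j))}) :
  {dffun forall j : 'I_r, 'I_(size (B j))} := [ffun j => if j == i then f0 j else f j].
have proj_inj : {in A &, injective proj}.
  move=> f g; rewrite !inE => /asboolP Xf /asboolP Xg /ffunP E.
  have E' j : j != i -> f j = g j.
    by move=> /negPf ji; have := E j; rewrite !ffunE ji.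
  have pq := inj _ _ Xf Xg (fun j ji => congr1 (fun x => nth 0 (B j) (val x)) (E' j ji)).
  apply/ffunP => j; have [->|] := eqVneq j i; last exact: E'.
  have := f_equal (fun p : point d => p i) pq; move/eqP; rewrite nth_uniq //.
  by move/eqP/val_inj.
rewrite -(card_in_imset proj_inj).
apply: (@leq_trans #|family F : simpl_pred {dffun forall j : 'I_r, 'I_(size (B j))}|).
  apply: subset_leq_card; apply/subsetP => _ /imsetP[f _ ->].
  by apply/familyP => j; rewrite ffunE unfold_in; case: eqP => //= ->.
rewrite card_family foldrE big_map big_enum /= [leqLHS](bigD1 i) //=.
rewrite (@eq_card1 _ (f0 i)) => [|x]; last by rewrite unfold_in /F eqxx.
rewrite mul1n; apply: leq_prod => j ji; apply: leq_trans (max_card _) _.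
by rewrite card_ord.
Qed.

(** As [u i] is supported on block [i], its multiples move the blocks independently and the
    translates of [p0] form a grid; as [u i] is nonzero, the [k] rows of each block are distinct. *)
Lemma directions_not_k_free (r : nat) (d : 'I_r -> nat) (X : point d -> Prop) (k : nat)
    (p0 : point d) (u : 'I_r -> nat -> R) :
  (forall i n, off_block d i n -> u i n = 0) ->
  (forall i, exists n, u i n <> 0) ->
  (forall (t : 'I_r -> nat), (forall i, (t i < k)%N) -> forall p,
     env_of p = (fun n => env_of p0 n + \sum_i (t i)%:R * u i n) -> X p) ->
  ~ k_free k X.
Proof.
move=> uoff un0 hX; apply; pose e := env_of p0.
pose tg i j : coord d := Tagged (fun i => 'I_(d i)) (j : 'I_(d i)).
pose row i (t : nat) : 'rV[R]_(d i) :=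
  \row_j (e (pos (tg i j)) + t%:R * u i (pos (tg i j))).
exists (fun i => [seq row i t | t <- iota 0 k]); split.
  split=> i; last by rewrite size_map size_iota.
  rewrite map_inj_uniq ?iota_uniq // => t t' /rowP E.
  have [n un] := un0 i.
  have [s [sn si]] : exists s : coord d, pos s = n /\ tag s = i.
    by apply: contrapT => nex; apply/un/uoff => s sn si; apply: nex; exists s.
  case: s sn si => i' j /= sn ii'; subst i'.
  have := E j; rewrite !mxE sn => /addrI /mulIf => /(_ (introN eqP un)) /eqP.
  by rewrite eqr_nat => /eqP.
move=> p pB.
have ex_t i : exists t, (t < k)%N /\ p i = row i t.
  by have /mapP[t] := pB i; rewrite mem_iota => tk ->; exists t.
have [t ht] := choice ex_t.
apply: (hX t) => [i|]; first by case: (ht i).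
apply/funext => n; have [[[i j] sn]|nout] := posP d n; last first.
  rewrite !env_of_out // big1 ?addr0 // => i _.
  by rewrite uoff ?mulr0 // => s /nout.
rewrite -{1}sn env_of_pos /= (bigD1 i) //= [X in _ + (_ + X)]big1 => [|i' i'i].
  by have [_ ->] := ht i; rewrite mxE addr0 -sn.
rewrite uoff ?mulr0 // => s; rewrite -sn => /pos_inj -> /= ii'.
by rewrite ii' eqxx in i'i.
Qed.

(** * Cells *)

(** [E] collects the integral equations created by the induction; no atom has this form. *)
Definition cell_holds (c : seq atom) (E : seq (aff int)) (m : nat -> int) (y : nat -> R) :=
  cholds m y c /\ forall f, List.In f E -> f m = 0.

Definition cell (r : nat) (d : 'I_r -> nat) (C : (nat -> int) -> (nat -> R) -> Prop)
    (p : point d) : Prop :=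
  exists m y, [/\ env_of p = join_env m y, frac_env y & C m y].

Definition tangent (c : seq atom) (E : seq (aff int)) (w : nat -> int) (v : nat -> R) :=
  (forall f, List.In f E -> lpart f w = 0) /\
  (forall f, List.In (REq f) c -> lpart f v = 0).

Definition on_block (r : nat) (d : 'I_r -> nat) (i : 'I_r) (w : nat -> int)
    (v : nat -> R) : Prop :=
  forall n, off_block d i n -> w n = 0 /\ v n = 0.

(** Two points of the cell that agree off block [i] differ by a tangent direction on that block,
    hence coincide, and [zar_inj] applies. *)
Lemma zar_no_tangent (r : nat) (d : 'I_r -> nat) c E (i : 'I_r) :
  (forall w v, on_block d i w v -> tangent c E w v ->
     (forall n, w n = 0) /\ (forall n, v n = 0)) ->
  zar (cell (d := d) (cell_holds c E)).
Proof.
move=> notan; apply: (zar_inj (i := i)) => p q [m [y [ep fy [cm Em]]]].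
move=> [m' [y' [eq fy' [cm' Em']]]] pq.
have blk : on_block d i (fun n => m n - m' n) (fun n => y n - y' n).
  move=> n nb.
  have : env_of p n = env_of q n.
    have [[s sn]|nout] := posP d n; last by rewrite !env_of_out.
    by rewrite -sn !env_of_pos pq //; apply/eqP/nb.
  rewrite ep eq => /(floor_frac_unique (fy n) (fy' n))[-> ->].
  by rewrite !subrr.
have [|w0 v0] := notan _ _ blk.
  split=> f fin; rewrite lpart_eq; first by rewrite Em // Em' // subrr.
  move/List.Forall_forall: cm => /(_ _ fin) /= ->.
  by move/List.Forall_forall: cm' => /(_ _ fin) /= ->; rewrite subrr.
rewrite -[p]env_ofK -[q]env_ofK ep eq; congr (point_of_env d _).
apply/funext => n; rewrite /join_env.
by rewrite (subr0_eq (w0 n)) (subr0_eq (v0 n)).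
Qed.

Lemma exists_upper (I : Type) (s : seq I) (b : I -> int) :
  exists T : nat, forall i, List.In i s -> b i <= T%:Z.
Proof.
elim: s => [|a s [T hT]]; first by exists 0%N.
exists (T + `|b a|)%N => i [<-|/hT]; lia.
Qed.

Lemma exists_small (I : Type) (s : seq I) (a b : I -> R) :
  (forall i, List.In i s -> 0 < a i) ->
  exists2 x, 0 < x & forall i, List.In i s -> 0 < a i - x * b i.
Proof.
(* Asking for all positive [z] up to [x] lets the induction shrink [x]. *)
move=> a0; suff [x x0 hx] : exists2 x, 0 < x & forall z, 0 < z <= x ->
    forall i, List.In i s -> 0 < a i - z * b i.
  by exists x => //; apply: hx; rewrite x0 lexx.
elim: s a0 => [|i s IHs] a0; first by exists 1.
have [|x x0 hx] := IHs; first by move=> j js; apply: a0; right.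
have ai : 0 < a i by apply: a0; left.
have b1 : 0 < `|b i| + 1 by rewrite ltr_wpDl.
exists (Num.min x (a i / (`|b i| + 1))).
  by rewrite lt_min x0 divr_gt0.
move=> z /andP[z0]; rewrite le_min ler_pdivlMr // => /andP[zx za] j [<-|js].
  have : z * b i <= z * `|b i| by rewrite ler_wpM2l ?ler_norm // ltW.
  by lra.
by apply: hx => //; rewrite z0.
Qed.

(* A nonzero pair of directions is replaced by one with a single nonzero component, so
   that the integral and fractional displacements cannot cancel; the integral one is
   scaled to preserve the congruences. *)
Lemma normalize_tangent (r : nat) (d : 'I_r -> nat) c E (i : 'I_r) w v :
  on_block d i w v -> tangent c E w v ->
  ~ ((forall n, w n = 0) /\ (forall n, v n = 0)) ->
  exists w' v', [/\ on_block d i w' v', tangent c E w' v',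
    forall N f, List.In (IDvd N f) c -> (N.+1%:Z %| lpart f w')%Z
    & exists n, (w' n <> 0 /\ v' n = 0) \/ (w' n = 0 /\ v' n <> 0)].
Proof.
move=> blk [tE tc] nz.
have [w0|w0] := pselect (forall n, w n = 0).
  exists w, v; split=> //.
    move=> N f _; rewrite (_ : w = fun=> 0) ?lpart0 ?dvdz0 //.
    exact/funext.
  have [n vn] : exists n, v n <> 0.
    apply: contrapT => nex; apply: nz; split=> // n; apply: contrapT => vn.
    by apply: nex; exists n.
  by exists n; right.
have [n wn] : exists n, w n <> 0.
  apply: contrapT => nex; apply: w0 => n; apply: contrapT => wn.
  by apply: nex; exists n.
exists (fun n => (period c)%:Z * w n), (fun=> 0); split.
- by move=> l /blk[-> _]; rewrite mulr0.
- split=> f fin; last by rewrite lpart0.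
  by rewrite lpart_scale tE // mulr0.
- move=> N f fin; rewrite lpart_scale dvdz_mulr //; exact: dvdn_period fin.
- exists n; left; split=> //; apply/eqP; rewrite mulf_neq0 //; last exact/eqP.
  by rewrite eqz_nat -lt0n period_gt0.
Qed.

(* Far from all its integral walls, a cell contains a cube in the tangent directions. *)
Lemma k_free_near_wall (r : nat) (d : 'I_r -> nat) c E k :
  (forall m y s, cell_holds c E m y -> 0 <= y (pos (d := d) s) < 1) ->
  k_free k (cell (d := d) (cell_holds c E)) ->
  (forall i, exists w v, [/\ on_block d i w v, tangent c E w v
     & ~ ((forall n, w n = 0) /\ (forall n, v n = 0))]) ->
  exists T : nat, forall (p : point d) m y, env_of p = join_env m y -> frac_env y ->
    cell_holds c E m y -> exists f, List.In (IPos f) c /\ f m <= T%:Z.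
Proof.
move=> hfrac kf hdir.
have ex_wv i : exists w v, [/\ on_block d i w v, tangent c E w v,
    forall N f, List.In (IDvd N f) c -> (N.+1%:Z %| lpart f w)%Z
    & exists n, (w n <> 0 /\ v n = 0) \/ (w n = 0 /\ v n <> 0)].
  by have [w [v [h1 h2 h3]]] := hdir i; apply: normalize_tangent h1 h2 h3.
have [w hw] := choice ex_wv; have [v hv] := choice hw.
(* A bound for the drop of [f] over the cube; it does not depend on the point, so [T] is uniform. *)
pose wall (a : atom) : int :=
  if a is IPos f then k%:Z * \sum_i `|lpart f (w i)| else 0.
have [T hT] := exists_upper c wall.
exists T => p0 m y ep fy [cm Em]; apply: contrapT => far.
have far' f : List.In (IPos f) c -> T%:Z < f m.
  by move=> fc; rewrite ltNge; apply/negP => fm; apply: far; exists f.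
move/List.Forall_forall: cm => cm.
(* A strict real inequality has only the margin [f y], so the real directions are shrunk by a factor
   [x] that may depend on the point. *)
pose base (a : atom) : R := if a is RPos f then f y else 1.
pose rate (a : atom) : R := if a is RPos f then k%:R * \sum_i `|lpart f (v i)| else 0.
have [|x x0 hx] := @exists_small _ c base rate.
  by move=> [f|N f|f|f] fc //; have := cm _ fc.
pose u i n : R := (w i n)%:~R + x * v i n.
apply: (@directions_not_k_free _ d (cell (cell_holds c E)) k p0 u) => //.
- by move=> i n /(let: And4 blk _ _ _ := hv i in blk n)[wn vn]; rewrite /u wn vn mulr0 addr0.
- move=> i; have [_ _ _ [n hn]] := hv i; exists n; rewrite /u.
  case: hn => -[wn vn].
    by rewrite vn mulr0 addr0; apply/eqP; rewrite intr_eq0; apply/eqP.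
  by rewrite wn add0r; apply/eqP; rewrite mulf_neq0 //; [rewrite gt_eqF|apply/eqP].
move=> t tk p epp.
pose m' n := m n + \sum_i (t i)%:Z * w i n.
pose y' n := y n + \sum_i (t i)%:R * (x * v i n).
have C' : cell_holds c E m' y'.
  split; last first.
    move=> f fE; rewrite /m' aff_sum Em // add0r big1 // => i _.
    by have [_ [tE _] _ _] := hv i; rewrite tE // mulr0.
  apply/List.Forall_forall => -[f|N f|f|f] fc /=; have fmy := cm _ fc.
  - have tk' i : 0 <= (t i)%:Z <= k%:Z by have := tk i; lia.
    apply: lt_le_trans (aff_sum_ge f _ m w tk').
    by rewrite subr_gt0; apply: le_lt_trans (hT _ fc) (far' _ fc).
  - rewrite /m' aff_sum rpredD //; apply: rpred_sum => i _.
    by have [_ _ dv _] := hv i; rewrite dvdz_mull // dv.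
  - have tk' i : 0 <= ((t i)%:R : R) <= k%:R by rewrite ler0n ler_nat ltnW.
    apply: lt_le_trans (aff_sum_ge f _ y (fun i n => x * v i n) tk').
    rewrite (eq_bigr (fun i => x * `|lpart f (v i)|)) => [|i _].
      by rewrite -mulr_sumr mulrCA; apply: (hx _ fc).
    by rewrite lpart_scale normrM gtr0_norm.
  - rewrite /y' (aff_sum f _ y _ (fun i n => x * v i n)) fmy add0r big1 // => i _.
    by have [_ [_ tc] _ _] := hv i; rewrite lpart_scale tc // !mulr0.
exists m', y'; split=> //.
  rewrite epp ep; apply/funext => n; rewrite /join_env /m' /y' /u intrD rmorph_sum.
  rewrite addrACA -big_split /=; congr (_ + _); apply: eq_bigr => i _.
  by rewrite intrM mulrDr.
(* On coordinates the cell itself forces the range [[0, 1)]; elsewhere no direction moves [y]. *)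
move=> n; have [[s <-]|nout] := posP d n; first exact: hfrac C'.
rewrite /y' big1 ?addr0 // => i _.
have [/(_ n)[s /nout//|_ ->]] := hv i.
by rewrite !mulr0.
Qed.

(** Induction on the length of [c]: when every block has a tangent direction, the slices [f = j]
    with [1 <= j <= T] cover the cell, and each trades an inequality for an equation. Slices are
    subsets, so they inherit both hypotheses. *)
Lemma zar_cell (r : nat) (d : 'I_r -> nat) c E k :
  (forall m y s, cell_holds c E m y -> 0 <= y (pos (d := d) s) < 1) ->
  k_free k (cell (d := d) (cell_holds c E)) -> zar (cell (d := d) (cell_holds c E)).
Proof.
have [l] := ubnP (size c); elim: l c E => // l IHl c E cl hfrac kf.
have [[i notan]|tan] := pselect (exists i, forall w v, on_block d i w v ->
    tangent c E w v -> (forall n, w n = 0) /\ (forall n, v n = 0)).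
  exact: zar_no_tangent notan.
have [|T hT] := k_free_near_wall hfrac kf.
  move=> i; apply: contrapT => nex; apply: tan; exists i => w v blk tg.
  by apply: contrapT => nz; apply: nex; exists w, v.
(* Defined for every atom, but empty unless the atom is an integral inequality. *)
pose slice a (j : nat) m y := cell_holds c E m y /\
  (if a is IPos f then f m = j%:Z else False).
apply: (@zar_sub _ d _ (fun p => exists a, List.In a c /\
    exists j, List.In j (iota 1 T) /\ cell (slice a j) p)).
  move=> p [m [y [ep fy C]]]; have [f [fc fT]] := hT p m y ep fy C.
  have f0 : 0 < f m by case: C => /List.Forall_forall /(_ _ fc).
  exists (IPos f); split=> //; exists `|f m|%N; split.
    by apply/In_mem; rewrite mem_iota; move: (f m : int) f0 fT => z; lia.
  by exists m, y; split=> //; split=> //; rewrite gtz0_abs.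
apply: zar_exists => a ac; apply: zar_exists => j /In_mem; rewrite mem_iota => j1.
case: a ac => [f|N f|f|f] ac; try by apply: zar_empty => p [m [y [_ _ []]]].
have [c1 [c2 cE]] := List.in_split _ _ ac.
pose E' := aadd f (aconst (- j%:Z)) :: E.
(* Since [j >= 1], the equation [f = j] implies [0 < f], which can leave the list. *)
have sliceE m y : slice (IPos f) j m y <-> cell_holds (c1 ++ c2) E' m y.
  rewrite /slice /cell_holds /cholds cE !List.Forall_app List.Forall_cons_iff /=.
  split=> [[[[h1 [_ h2]] hE] fj]|[[h1 h2] hE]].
    by split=> // g [<-|/hE//] /=; rewrite fj subrr.
  have fj : f m = j%:Z.
    by apply/eqP; rewrite -subr_eq0; apply/eqP; apply: (hE (aadd f (aconst (- j%:Z)))); left.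
  split=> //; split; last by move=> g gE; apply: hE; right.
  by split=> //; split=> //; rewrite fj; lia.
have subC m y : cell_holds (c1 ++ c2) E' m y -> cell_holds c E m y.
  by move=> /sliceE[].
apply: (@zar_sub _ d _ (cell (cell_holds (c1 ++ c2) E'))).
  by move=> p [m [y [ep fy /sliceE C]]]; exists m, y.
apply: IHl.
- by move: cl; rewrite cE !size_cat /=; lia.
- by move=> m y s /subC; apply: hfrac.
- by apply: k_free_sub kf => p [m [y [ep fy /subC C]]]; exists m, y.
Qed.

(** * From cells to definable sets *)

Lemma zar_definable (r : nat) (d : 'I_r -> nat) (X : point d -> Prop) (k : nat) :
  definable X -> k_free k X -> zar X.
Proof.
case=> phi hphi kf; have [P [dP hP]] := sat_dnf phi.
(* The bounds [0 <= y < 1] on coordinates join the predicate, so that every cell of its normal form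
   forces them, as [zar_cell] requires. *)
pose Q m y := P m y /\ forall s, List.In s (enum (coord d)) ->
  ~ aholds m y (RPos (ascale (-1) (avar _ (pos s)))) /\
  aholds m y (RPos (aadd (aconst 1) (ascale (-1) (avar _ (pos s))))).
have [L hL] : dnf Q.
  apply: dnf_and => //; apply: dnf_forall => s _.
  by apply: dnf_and; [apply: dnf_natom|apply: dnf_atom].
have QE m y : Q m y <-> P m y /\ forall s : coord d, 0 <= y (pos s) < 1.
  rewrite /Q /=; split=> -[hPmy h]; split=> // s.
    have [] := h s; first by apply/In_mem; rewrite mem_enum.
    by move=> h1 h2; lra.
  by have := h s; split; lra.
have cellQ c : List.In c L -> forall m y, cell_holds c [::] m y -> Q m y.
  by move=> cL m y [hc _]; apply/hL/List.Exists_exists; exists c.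
have XE m y : frac_env y -> X (point_of_env d (join_env m y)) <-> P m y.
  by move=> fy; rewrite hphi hP.
apply: (@zar_sub _ d _ (fun p => exists c, List.In c L /\ cell (cell_holds c [::]) p)).
  move=> p Xp; have [m [y [ep fy]]] := join_env_exists (env_of p).
  have /hL/List.Exists_exists[c [cL hc]] : Q m y.
    by apply/QE; split=> [|s]; [apply/XE => //; rewrite -ep env_ofK|apply: fy].
  by exists c; split=> //; exists m, y.
apply: zar_exists => c cL; apply: (@zar_cell _ d c [::] k).
  by move=> m y s /(cellQ c cL)/QE[_].
apply: k_free_sub kf => p [m [y [ep fy /(cellQ c cL)/QE[hPmy _]]]].
by rewrite -[p]env_ofK ep; apply/XE.
Qed.

Theorem theorem5p21 (r : nat) (d : 'I_r -> nat)
    (hr : (0 < r)%N) (hd : forall i : 'I_r, (0 < d i)%N)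
    (X : point d -> Prop) (hX : definable X) :
  exists alpha : R, 0 < alpha /\
    ((exists k : nat, (1 <= k)%N /\ k_free k X) ->
     forall B : fgrid d, wf_grid B ->
       (card_inter X B)%:R <= alpha * (delta B)%:R).
Proof.
(* [X] is fixed, so [alpha] may come from one [k] for which it is k-free; without such a [k] the
   bound is vacuous. *)
have [[k [_ kf]]|nk] := pselect (exists k : nat, (1 <= k)%N /\ k_free k X); last first.
  by exists 1; split.
have [a ha] := zar_definable hX kf.
exists a.+1%:R; split=> [|_ B wB]; first by rewrite ltr0n.
rewrite -natrM ler_nat; apply: leq_trans (ha B wB) _.
by rewrite leq_mul2r leqnSn orbT.
Qed.
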